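(* Let $n\ge 2$, let $A_1,\dots,A_m,C$ be real symmetric $n\times n$ matrices and $b\in\mathbb{R}^m$, and assume that the semidefinite program $$(P)\qquad \inf\ \langle C,X\rangle\quad\text{s.t.}\quad \langle A_i,X\rangle=b_i\ (i=1,\dots,m),\quad X\succeq 0$$ is feasible. If the Ramana dual $(D_{\rm Ram})$ of $(P)$ is strictly feasible, then the only feasible solution of $(P)$ is $X=0$.
   Context: $\mathcal{S}^n$ is the set of real symmetric $n\times n$ matrices and $\mathcal{S}^n_+$ the set of positive semidefinite (psd) ones. $\langle S,T\rangle=\mathrm{trace}(ST)$ for symmetric matrices, $\langle b,y\rangle=b^\top y$ for vectors, and $\mathcal{A}^*y=\sum_{i=1}^m y_iA_i$. For $U\in\mathcal{S}^n_+$, $$\tan(U)=\Bigl\{W+W^\top : W\in\mathbb{R}^{n\times n},\ \begin{pmatrix} U & W \\ W^\top & R \end{pmatrix}\in\mathcal{S}^{2n}_+\ \text{for some } R\in\mathcal{S}^n_+\Bigr\}.$$ The Ramana dual of $(P)$ is $$(D_{\rm Ram})\qquad \sup\ \langle b,y\rangle$$ over $y,y^1,\dots,y^{n-1}\in\mathbb{R}^m$ and symmetric $n \times n$ matrices $U_0,\dots,U_{n-1},V_0,\dots,V_{n-1}$, subject to $C-\mathcal{A}^*y\in\mathcal{S}^n_++\tan(U_{n-1})$, $U_0=V_0=0$, and, for $i=1,\dots,n-1$: $\mathcal{A}^*y^i=U_i+V_i$, $\langle b,y^i\rangle=0$, $U_i\in\mathcal{S}^n_+$, $V_i\in\tan(U_{i-1})$.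 Since $\tan(0)=\{0\}$, always $V_1=0$. Strict feasibility of $(D_{\rm Ram})$ means that it has a feasible solution in which all the semidefiniteness constraints hold strictly: $U_1,\dots,U_{n-1}$ are positive definite; for each $i=2,\dots,n-1$ one has $V_i=W_i+W_i^\top$ with $\begin{pmatrix} U_{i-1} & W_i \\ W_i^\top & R_i \end{pmatrix}$ positive definite for some $R_i$; and $C-\mathcal{A}^*y=S+W_n+W_n^\top$ with $S$ positive definite and $\begin{pmatrix} U_{n-1} & W_n \\ W_n^\top & R_n \end{pmatrix}$ positive definite for some $R_n$. (The constraint $V_1\in\tan(U_0)$ is read simply as $V_1=0$.) *)

(* Defs.v *)
From HB Require Import structures.
From mathcomp Require Import all_boot all_order all_algebra.
From mathcomp Require Import reals.

Set Implicit Arguments.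
Unset Strict Implicit.
Unset Printing Implicit Defensive.

Import Order.TTheory GRing.Theory Num.Theory.
Local Open Scope ring_scope.

Definition psd (R : realType) (n : nat) (S : 'M[R]_n) : Prop :=
  S \is symmetricmx /\ forall x : 'cV[R]_n, 0 <= (x^T *m S *m x) 0 0.

Definition posdef (R : realType) (n : nat) (S : 'M[R]_n) : Prop :=
  S \is symmetricmx /\
  forall x : 'cV[R]_n, x != 0 -> 0 < (x^T *m S *m x) 0 0.

Definition mxdot (R : realType) (n : nat) (S T : 'M[R]_n) : R := \tr (S *m T).

Definition vdot (R : realType) (m : nat) (b y : 'cV[R]_m) : R :=
  (b^T *m y) 0 0.

(* The map y |-> A^* y. *)
Definition adj_map (R : realType) (n m : nat) (A : 'I_m -> 'M[R]_n)
  (y : 'cV[R]_m) : 'M[R]_n := \sum_(i < m) y i 0 *: A i.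

Definition tan_space (R : realType) (n : nat) (U T : 'M[R]_n) : Prop :=
  exists W Q : 'M[R]_n,
    [/\ T = W + W^T, psd Q & psd (block_mx U W W^T Q)].

Definition sdp_feasible (R : realType) (n m : nat) (A : 'I_m -> 'M[R]_n)
  (b : 'cV[R]_m) (X : 'M[R]_n) : Prop :=
  psd X /\ forall i : 'I_m, mxdot (A i) X = b i 0.

(* Feasibility for the Ramana dual.  The families ys, U and V are indexed by
   nat, but only ys i for 1 <= i <= n-1 and U i, V i for 0 <= i <= n-1 are
   variables of the problem: the other values are unused. *)
Definition ramana_feasible (R : realType) (n m : nat) (A : 'I_m -> 'M[R]_n)
  (b : 'cV[R]_m) (C : 'M[R]_n) (y : 'cV[R]_m) (ys : nat -> 'cV[R]_m)
  (U V : nat -> 'M[R]_n) : Prop :=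
  [/\ forall i : nat, (i < n)%N ->
        U i \is symmetricmx /\ V i \is symmetricmx,
      exists S T : 'M[R]_n,
        [/\ psd S, tan_space (U n.-1) T & C - adj_map A y = S + T],
      U 0%N = 0 /\ V 0%N = 0
    & forall i : nat, (1 <= i < n)%N ->
        [/\ adj_map A (ys i) = U i + V i,
            vdot b (ys i) = 0,
            psd (U i)
          & tan_space (U i.-1) (V i)]].

(* A feasible solution of the Ramana dual at which every semidefiniteness
   constraint holds strictly.  As tan_space 0 contains only 0, the constraint
   on V 1 has no strict version and is read as V 1 = 0. *)
Definition ramana_strictly_feasible (R : realType) (n m : nat)
  (A : 'I_m -> 'M[R]_n) (b : 'cV[R]_m) (C : 'M[R]_n) : Prop :=
  exists (y : 'cV[R]_m) (ys : nat -> 'cV[R]_m) (U V : nat -> 'M[R]_n),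
    [/\ ramana_feasible A b C y ys U V,
        forall i : nat, (1 <= i < n)%N -> posdef (U i),
        V 1%N = 0,
        forall i : nat, (2 <= i < n)%N ->
          exists W Q : 'M[R]_n,
            V i = W + W^T /\ posdef (block_mx (U i.-1) W W^T Q)
      & exists S W Q : 'M[R]_n,
          [/\ C - adj_map A y = S + W + W^T,
              posdef S
            & posdef (block_mx (U n.-1) W W^T Q)]].

(* Main.v *)
Require Import Defs.
From HB Require Import structures.
From mathcomp Require Import all_boot all_order all_algebra.
From mathcomp Require Import reals.
From mathcomp Require Import ring.

Set Implicit Arguments.
Unset Strict Implicit.
Unset Printing Implicit Defensive.

Import Order.TTheory GRing.Theory Num.Theory.
Local Open Scope ring_scope.

(** The first stage of the Ramana dual forces [X = 0].  Since [V 1 = 0], it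
    reads [A^* y^1 = U_1] with [<b, y^1> = 0], so every feasible [X] satisfies
    [<U_1, X> = <b, y^1> = 0].  Strict feasibility makes [U_1] positive
    definite, and a psd matrix orthogonal to a positive definite one vanishes
    ([posdef_orthogonal_eq0]): writing [X = L L^T] ([psd_gram]), the trace
    [<U_1, X>] is the sum of the values of the quadratic form [U_1] at the
    columns of [L].  Conversely, [0] is feasible because some feasible point
    exists and it must be [0]. *)

Lemma symmetricmxP (R : realType) n (S : 'M[R]_n) :
  reflect (S^T = S) (S \is symmetricmx).
Proof.
apply: (iffP idP) => [|ST]; rewrite is_hermitianmxE expr0 scale1r map_mx_id //.
  by move=> /eqP {2}->.
by rewrite ST.
Qed.

Lemma sqnorm_eq0 (R : realType) n (v : 'cV[R]_n) :
  (v^T *m v) 0 0 = 0 -> v = 0.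
Proof.
rewrite mxE => /psumr_eq0P v0; apply/colP => i; rewrite mxE.
have /eqP : v^T 0 i * v i 0 = 0.
  by apply: v0 => // j _; rewrite mxE -expr2 sqr_ge0.
by rewrite mxE mulf_eq0 orbb => /eqP.
Qed.

Lemma mulmx_trC (R : realType) n (v z : 'cV[R]_n) : z^T *m v = v^T *m z.
Proof. by rewrite [RHS]mx11_scalar -tr_scalar_mx -mx11_scalar trmx_mul trmxK. Qed.

Lemma quad_block (R : realType) n (a t : R) (v z : 'cV[R]_n) (B : 'M[R]_n) :
  ((col_mx t%:M z)^T *m block_mx a%:M v^T v B *m col_mx t%:M z) 0 0
  = a * t ^+ 2 + (v^T *m z) 0 0 * t *+ 2 + (z^T *m B *m z) 0 0.
Proof.
rewrite tr_col_mx mul_row_block mul_row_col !mulmxDl tr_scalar_mx.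
rewrite !mul_scalar_mx !mul_mx_scalar -!scalemxAl scale_scalar_mx.
rewrite (mulmx_trC v z).
move: (v^T *m z) (z^T *m B *m z) => w q; rewrite !mxE eqxx mulr1n; ring.
Qed.

(** If the corner [a] vanishes, the quadratic form at [(t, v)] is affine in
    [t], so it can stay nonnegative only if its slope [2 |v|^2] is zero. *)
Lemma psd_corner0 (R : realType) n (v : 'cV[R]_n) (B : 'M[R]_n) :
  psd (block_mx (0 : R)%:M v^T v B) -> v = 0.
Proof.
case=> _ q_ge0; apply: sqnorm_eq0; apply/eqP/negPn/negP => w0.
set w := (v^T *m v) 0 0 in w0; set q := (v^T *m B *m v) 0 0.
have := q_ge0 (col_mx (- (q + 1) / (w *+ 2))%:M v).
rewrite quad_block -/w -/q.
have -> : 0 * (- (q + 1) / (w *+ 2)) ^+ 2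
          + w * (- (q + 1) / (w *+ 2)) *+ 2 + q = - 1 by field.
by rewrite oppr_ge0 ler10.
Qed.

(** The Schur complement at [z] is the value of the whole form at [(t, z)],
    where [t = - a^-1 <v, z>] is the minimizer when [a > 0].  For [a = 0] the
    convention [a^-1 = 0] gives [t = 0], and the same identity holds. *)
Lemma psd_schur (R : realType) n (a : R) (v : 'cV[R]_n) (B : 'M[R]_n) :
  psd (block_mx a%:M v^T v B) -> psd (B - a^-1 *: (v *m v^T)).
Proof.
case=> /symmetricmxP; rewrite tr_block_mx => /eq_block_mx[_ _ _ BT] q_ge0.
split=> [|z].
  by apply/symmetricmxP; rewrite linearB linearZ /= trmx_mul trmxK BT.
have := q_ge0 (col_mx (- (a^-1 * (v^T *m z) 0 0))%:M z).
rewrite quad_block; congr (0 <= _).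
rewrite mulmxBr mulmxBl -scalemxAr -scalemxAl.
rewrite (mulmxA z^T v) (mulmx_trC v z) -(mulmxA _ v^T z).
move: (v^T *m z) (z^T *m B *m z) => w q; rewrite !mxE big_ord1.
have [->|a0] := eqVneq a 0; first by rewrite invr0; ring.
by field.
Qed.

(** Cholesky factorization, by induction on the size: the first column of the
    factor is the first column of [X] divided by the square root of its corner
    entry, and the rest factors the Schur complement. *)
Lemma psd_gram (R : realType) n (X : 'M[R]_n) :
  psd X -> exists L : 'M[R]_n, X = L *m L^T.
Proof.
elim: n X => [|n IHn] X Xpsd.
  by exists 0; rewrite [LHS]flatmx0 [RHS]flatmx0.
pose X' : 'M_(1 + n) := X; pose a := ulsubmx X' 0 0; pose v := dlsubmx X'.
pose B := drsubmx X'.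
have XE : X = block_mx a%:M v^T v B.
  have /symmetricmxP XT := Xpsd.1.
  by rewrite -[LHS](@submxK _ 1 n 1 n) [ulsubmx _]mx11_scalar /v trmx_dlsub XT.
rewrite XE in Xpsd; have [L' BE] := IHn _ (psd_schur Xpsd).
have a_ge0 : 0 <= a.
  have := Xpsd.2 (col_mx (1%:M : 'M_1) (0 : 'cV_n)).
  by rewrite quad_block !mulmx0 mxE mul0r mul0rn !addr0 expr1n mulr1.
pose s := Num.sqrt a.
(* For a = 0 this is the vanishing of v, as s^-1 = 0. *)
have vE : s *: (s^-1 *: v) = v.
  have [a0|a0] := eqVneq a 0.
    by rewrite a0 in Xpsd; rewrite (psd_corner0 Xpsd) !scaler0.
  by rewrite scalerA divff ?scale1r // sqrtr_eq0 -ltNge lt_def a0.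
exists (block_mx s%:M 0 (s^-1 *: v) L').
rewrite XE (@tr_block_mx _ 1 n 1 n) (@mulmx_block _ 1 n 1 n 1 n).
rewrite tr_scalar_mx trmx0 !mulmx0 !mul0mx !addr0 -BE.
rewrite mul_scalar_mx mul_mx_scalar scale_scalar_mx -expr2 sqr_sqrtr //.
rewrite mul_scalar_mx -[s *: _^T]linearZ /= vE linearZ /= -scalemxAl -scalemxAr.
by rewrite scalerA -expr2 exprVn sqr_sqrtr // addrC subrK.
Qed.

(** For [X = L L^T] the trace is a sum of values of a positive definite form
    at the columns of [L], so each column is zero. *)
Lemma posdef_orthogonal_eq0 (R : realType) n (U X : 'M[R]_n) :
  posdef U -> psd X -> mxdot U X = 0 -> X = 0.
Proof.
case=> _ Upos /psd_gram[L ->].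
have trE : mxdot U (L *m L^T) = \sum_j ((col j L)^T *m U *m col j L) 0 0.
  rewrite /mxdot mulmxA mxtrace_mulC mulmxA; apply: eq_bigr => j _.
  rewrite tr_col -row_mul [in RHS]mxE [LHS]mxE.
  by apply: eq_bigr => k _; rewrite !mxE.
have q_ge0 (x : 'cV[R]_n) : 0 <= (x^T *m U *m x) 0 0.
  have [->|/Upos/ltW//] := eqVneq x 0; by rewrite mulmx0 mxE.
rewrite trE => /psumr_eq0P L0.
suff -> : L = 0 by rewrite mul0mx.
apply/matrixP => i j; apply/eqP/negPn/negP => Lij.
have /Upos : col j L != 0.
  by apply: contraNneq Lij => /colP/(_ i); rewrite !mxE => ->.
by rewrite L0 ?ltxx.
Qed.

Lemma mxdot_adj_map (R : realType) n m (A : 'I_m -> 'M[R]_n) (b y : 'cV[R]_m)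
    (X : 'M[R]_n) :
  sdp_feasible A b X -> mxdot (adj_map A y) X = vdot b y.
Proof.
case=> _ AX; rewrite /mxdot /adj_map /vdot mulmx_suml raddf_sum /= mxE.
by apply: eq_bigr => i _; rewrite -scalemxAl linearZ /= -/(mxdot _ _) AX mxE
  mulrC.
Qed.

Theorem mainTheorem2 (R : realType) (n m : nat) (hn : (2 <= n)%N)
  (A : 'I_m -> 'M[R]_n) (C : 'M[R]_n) (b : 'cV[R]_m)
  (hA : forall i : 'I_m, A i \is symmetricmx) (hC : C \is symmetricmx)
  (hP : exists X : 'M[R]_n, sdp_feasible A b X)
  (hD : ramana_strictly_feasible A b C) :
  forall X : 'M[R]_n, sdp_feasible A b X <-> X = 0.
Proof.
have [_ [ys [U [V [[_ _ _ stage] Upos V1 _ _]]]]] := hD.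
have feas0 X : sdp_feasible A b X -> X = 0.
  move=> fX; apply: (posdef_orthogonal_eq0 (Upos 1%N hn) fX.1).
  have [yU by0 _ _] := stage 1%N hn.
  by rewrite -by0 -(mxdot_adj_map _ fX) yU V1 addr0.
move=> X; split=> [/feas0 //|->].
by have [X0 fX0] := hP; rewrite -(feas0 _ fX0).
Qed.
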